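(* Let $m\ge 3$ and $l\ge 1$ be integers. Let $C_m$ be the cycle $v_1v_2\dotsm v_mv_1$ and let $P_l$ be the path $v_{m+1}v_{m+2}\dotsm v_{m+l}$. Let $L(\mathrm{Tp}_{m,l})$ be the labeled graph on $v_1,\dots,v_{m+l}$ obtained from the disjoint union of $C_m$ and $P_l$ by adding the two edges $v_1v_{m+1}$ and $v_mv_{m+1}$. Then $L(\mathrm{Tp}_{m,l})$ is $(e)$-positive.
   Context: Let $G$ be a finite simple graph with vertices labeled $v_1,\dots,v_d$. Its chromatic symmetric function in noncommuting variables is $Y_G=\sum_\kappa x_{\kappa(v_1)}x_{\kappa(v_2)}\dotsm x_{\kappa(v_d)}$, where $x_1,x_2,\dots$ are noncommuting variables and the sum is over all proper colorings $\kappa\colon V(G)\to\{1,2,3,\dots\}$. Let $\Pi_d$ be the set of set partitions of $[d]=\{1,\dots,d\}$. For $\pi\in\Pi_d$, let $e_\pi=\sum_{(i_1,\dots,i_d)}x_{i_1}\dotsm x_{i_d}$, where the sum is over all sequences $(i_1,\dots,i_d)$ of positive integers such that $i_j\ne i_k$ whenever $j\neq k$ lie in the same block of $\pi$. The $e_\pi$, $\pi\in\Pi_d$, are linearly independent over $\mathbb{Q}$ and $Y_G$ is uniquely a rational linear combination $Y_G=\sum_{\sigma\in\Pi_d}c_\sigma e_\sigma$. The type $\lambda(\pi)$ is the integer partition of $d$ formed by the block sizes of $\pi$, and $b_\pi$ is the size of the block of $\pi$ containing $d$. Write $\pi\equiv\sigma$ if $\lambda(\pi)=\lambda(\sigma)$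 and $b_\pi=b_\sigma$; let $(\pi)$ be the equivalence class of $\pi$, and set $c_{(\pi)}=\sum_{\sigma\in(\pi)}c_\sigma$. The labeled graph $G$ is called $(e)$-positive if $c_{(\pi)}\ge 0$ for every equivalence class $(\pi)\subseteq\Pi_d$. Here $d=m+l$. The graph $L(\mathrm{Tp}_{m,l})$ is the line graph of the tadpole consisting of a cycle of length $m$ with a pendant path having $l$ edges attached at one vertex of the cycle. *)

(* Defs.v *)
From mathcomp Require Import all_boot all_order all_algebra.

Set Implicit Arguments.
Unset Strict Implicit.
Unset Printing Implicit Defensive.

Import GRing.Theory Num.Theory.
Local Open Scope ring_scope.

(* The vertex v_k (1 <= k <= d), the position k in a word of length d and the
   element k of [d] are all represented by the ordinal of 'I_d of value k - 1;
   the variable x_k (k >= 1) by the natural number k - 1. *)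

Record labeled_graph (d : nat) := LabeledGraph {
  adj :> rel 'I_d;
  adj_sym : symmetric adj;
  adj_irr : irreflexive adj }.

Definition word (d : nat) := {ffun 'I_d -> nat}.

(* Homogeneous formal series of degree d in the noncommuting variables, given
   by the coefficients of the monomials x_(w_1) ... x_(w_d). *)
Definition nc_series (d : nat) := word d -> rat.

(* The formal sum of x_(w_1) ... x_(w_d) over all words w satisfying P:
   distinct words are distinct monomials, so every coefficient is 0 or 1. *)
Definition sum_words (d : nat) (P : pred (word d)) : nc_series d :=
  fun w => (P w)%:R.

(* A coloring k of v_1, ..., v_d is identified with the word
   k(v_1) ... k(v_d). *)
Definition proper_coloring (d : nat) (G : labeled_graph d) : pred (word d) :=
  fun k => [forall i, forall j, G i j ==> (k i != k j)].

Definition Y (d : nat) (G : labeled_graph d) : nc_series d :=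
  sum_words (proper_coloring G).

Definition set_partition (d : nat) : pred {set {set 'I_d}} :=
  fun pi => partition pi [set: 'I_d].

Definition distinct_on_blocks (d : nat) (pi : {set {set 'I_d}}) :
    pred (word d) :=
  fun w => [forall B in pi, forall j in B, forall k in B,
              (j != k) ==> (w j != w k)].

Definition e_ (d : nat) (pi : {set {set 'I_d}}) : nc_series d :=
  sum_words (distinct_on_blocks pi).

Definition e_expansion (d : nat) (f : nc_series d)
    (c : {set {set 'I_d}} -> rat) : Prop :=
  forall w : word d,
    f w = \sum_(sigma | set_partition sigma) c sigma * e_ sigma w.

Definition ptype (d : nat) (pi : {set {set 'I_d}}) : seq nat :=
  sort geq [seq #|B| | B : {set 'I_d} in pi].

(* For d > 0 the sum has a single term, indexed by the element d of [d]. *)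
Definition last_block_size (d : nat) (pi : {set {set 'I_d}}) : nat :=
  (\sum_(i < d | i.+1 == d) #|pblock pi i|)%N.

Definition pequiv (d : nat) : rel {set {set 'I_d}} :=
  fun pi sigma =>
    (ptype pi == ptype sigma) && (last_block_size pi == last_block_size sigma).

Definition class_coef (d : nat) (c : {set {set 'I_d}} -> rat)
    (pi : {set {set 'I_d}}) : rat :=
  \sum_(sigma | set_partition sigma && pequiv pi sigma) c sigma.

(* The e_ sigma, for sigma a set partition, are linearly independent, so the
   values of c on set partitions are determined by e_expansion (Y G) c. *)
Definition e_positive (d : nat) (G : labeled_graph d) : Prop :=
  exists c : {set {set 'I_d}} -> rat,
    e_expansion (Y G) c /\
    forall pi, set_partition pi -> 0 <= class_coef c pi.

(* The edges v_a v_b of L(Tp_(m,l)), each in one orientation, with a and b the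
   labels counted from 1; the bound b <= m + l comes from the vertex set. *)
Definition ltp_edge (m a b : nat) : bool :=
  [|| [&& b == a.+1 & b <= m],
      (a == m) && (b == 1),
      [&& b == a.+1 & m.+1 <= a],
      (a == 1) && (b == m.+1)
    | (a == m) && (b == m.+1)]%N.

(* The test i != j is redundant for m >= 3; it makes the graph simple for
   every m. *)
Definition ltp_adj (m l : nat) : rel 'I_(m + l) :=
  fun i j =>
    (i != j) && (ltp_edge m i.+1 j.+1 || ltp_edge m j.+1 i.+1).

Lemma ltp_adj_sym (m l : nat) : symmetric (@ltp_adj m l).
Proof. by move=> i j; rewrite /ltp_adj eq_sym orbC. Qed.

Lemma ltp_adj_irr (m l : nat) : irreflexive (@ltp_adj m l).
Proof. by move=> i; rewrite /ltp_adj eqxx. Qed.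

Definition line_tadpole (m l : nat) : labeled_graph (m + l) :=
  LabeledGraph (@ltp_adj_sym m l) (@ltp_adj_irr m l).

(* Main.v *)
(* Let f~g mean that f - g is a linear combination of differences F - F o s,
   with F invariant under renaming letters and s an involution of the positions
   fixing the last one; every such F is a combination of the e_pi, so f - g has
   zero class coefficients. If F forces distinct letters on a set B of positions
   containing the last one and is symmetric in B, then the series F(w)[x = last
   letter of w] in one more letter x is ~ (1/|B|) (F(w) - F(w)[x not in w(B)]).
   Write E(a,n) = Z_a [letters a..n-1 distinct], where Z_n is the sum over the
   compositions (k_1,...,k_r) of n of prod (k_i - 1)/k_i! times "distinct on
   consecutive blocks of sizes k_1,...,k_r". With k = n - a,
   deletion-contraction gives P_n ~ sum_a k/k! E(a,n), then
   C_n ~ sum_a k(k-1)/k! E(a,n), since the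
   contraction of C_(n+1) is C_n with its last letter repeated. Attaching the
   triangle subtracts this repetition twice (a reflection exchanges v_1 and
   v_m), and the resulting coefficients are (k-1)(k-2)/k! and 2(k-1)/k!. Finally,
   attaching a pendant vertex at the last vertex turns e_pi into
   (1 - 1/b) e_(pi, new singleton) + (1/b) e_(pi, new vertex in the last block),
   which preserves positivity. *)
Require Import Defs.
From mathcomp Require Import all_boot all_order all_algebra.
From mathcomp Require Import ring zify.

Set Implicit Arguments.
Unset Strict Implicit.
Unset Printing Implicit Defensive.

Import Order.TTheory GRing.Theory Num.Theory.
Local Open Scope ring_scope.

(** * Series and linear spans *)

(** Words are infinite here, so that their length can grow in an induction without casts; the degree
    reappears in [kernel_inv n] and [null N]. *)
Definition series := (nat -> nat) -> rat.

Inductive lin (G : series -> Prop) : series -> Prop :=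
| lin_gen f : G f -> lin G f
| lin_zero : lin G (fun=> 0)
| lin_comb a f g : lin G f -> lin G g -> lin G (fun w => a * f w + g w)
| lin_ext f g : lin G f -> f =1 g -> lin G g.

Lemma lin_scale (G : series -> Prop) a f : lin G f -> lin G (fun w => a * f w).
Proof.
move=> Gf; apply: (lin_ext (lin_comb a Gf (lin_zero G))) => w.
by rewrite addr0.
Qed.

Lemma lin_sum (G : series -> Prop) (I : eqType) (r : seq I) (F : I -> series) :
  (forall i, i \in r -> lin G (F i)) -> lin G (fun w => \sum_(i <- r) F i w).
Proof.
elim: r => [|i r IHr] GF.
  by apply: (lin_ext (lin_zero G)) => w; rewrite big_nil.
have Gi : lin G (F i) by apply: GF; rewrite mem_head.
have Gr : lin G (fun w => \sum_(j <- r) F j w).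
  by apply: IHr => j jr; apply: GF; rewrite inE jr orbT.
by apply: (lin_ext (lin_comb 1 Gi Gr)) => w; rewrite big_cons mul1r.
Qed.

Lemma lin_mul (G H : series -> Prop) (phi : series) f :
  (forall f, G f -> lin H (fun w => f w * phi w)) ->
  lin G f -> lin H (fun w => f w * phi w).
Proof.
move=> GH; elim=> {f} [f /GH //||a f g _ IHf _ IHg|f g _ IHf fg].
- by apply: (lin_ext (lin_zero H)) => w; rewrite mul0r.
- by apply: (lin_ext (lin_comb a IHf IHg)) => w; rewrite mulrDl mulrA.
- by apply: (lin_ext IHf) => w; rewrite fg.
Qed.

(* The e-series of the kernel of g on the positions a, ..., n-1. *)
Definition dist (a n : nat) (g w : nat -> nat) : bool :=
  all (fun i => all (fun j => (i != j) && (g i == g j) ==> (w i != w j))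
    (index_iota a n)) (index_iota a n).

Lemma distP a n g w :
  reflect (forall i j, (a <= i < n)%N -> (a <= j < n)%N -> i != j ->
             g i = g j -> w i != w j)
          (dist a n g w).
Proof.
apply: (iffP allP) => [gw i j ni nj ij gij|gw i].
  have := gw i; rewrite mem_index_iota => /(_ ni)/allP/(_ j).
  by rewrite mem_index_iota => /(_ nj); rewrite ij gij eqxx.
rewrite mem_index_iota => ni; apply/allP => j; rewrite mem_index_iota => nj.
by apply/implyP => /andP[ij /eqP gij]; apply: gw.
Qed.

(** * Kernels of words and invariance under renaming letters *)

Definition same_kernel (n : nat) (w w' : nat -> nat) : bool :=
  all (fun i => all (fun j => (w i == w j) == (w' i == w' j)) (iota 0 n))
    (iota 0 n).

Lemma same_kernelP n w w' :
  reflect (forall i j, (i < n)%N -> (j < n)%N ->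
             (w i == w j) = (w' i == w' j))
          (same_kernel n w w').
Proof.
apply: (iffP allP) => [ww' i j ni nj|ww' i].
  have := ww' i; rewrite mem_iota => /(_ ni)/allP/(_ j).
  by rewrite mem_iota => /(_ nj) /eqP.
rewrite mem_iota => ni; apply/allP => j; rewrite mem_iota => nj.
by apply/eqP/ww'.
Qed.

Lemma same_kernel_sym n w w' : same_kernel n w w' = same_kernel n w' w.
Proof.
by apply/same_kernelP/same_kernelP => ww' i j ni nj; rewrite ww'.
Qed.

Lemma same_kernel_trans n w1 w2 w3 :
  same_kernel n w1 w2 -> same_kernel n w1 w3 = same_kernel n w2 w3.
Proof.
move=> /same_kernelP w12.
by apply/same_kernelP/same_kernelP => ww' i j ni nj; rewrite -ww' ?w12.
Qed.

(** The symmetric functions of degree [n] in noncommuting variables, seen through their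
    coefficients. *)
Definition kernel_inv (n : nat) (f : series) : Prop :=
  forall w w', same_kernel n w w' -> f w = f w'.

Definition is_e (n : nat) (f : series) : Prop :=
  exists g, f = fun w => (dist 0 n g w)%:R.

(** * The e-series span the invariant series *)

(** Pairing [g] with [h] gives the partitions refining the kernel of [h]; [pickle] codes the pairs
    as the numeric labels that [dist] expects. *)
Definition is_pair_e (h : nat -> nat) (n : nat) (f : series) : Prop :=
  exists g : nat -> nat, f = fun w => (dist 0 n (fun i => pickle (h i, g i))
    w)%:R.

Definition rank (h w : nat -> nat) (k : nat) : nat :=
  count (fun j => (h j == h k) && (w j == w k)) (iota 0 k).

Lemma pickle_eq (T : countType) (x y : T) : (pickle x == pickle y) = (x == y).
Proof. exact: inj_eq (pcan_inj pickleK) _ _. Qed.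

Lemma is_pair_e_rank h k t f :
  is_pair_e h k f ->
  lin (is_pair_e h k.+1) (fun w => f w * (t - (rank h w k)%:R)).
Proof.
case=> g ->.
have [K gK] : exists K, forall j, (j < k)%N -> (g j < K)%N.
  exists (\max_(j < k) g j).+1 => j jk.
  by rewrite ltnS (leq_bigmax (Ordinal jk)).
pose upd c i := if i == k then c else g i.
have lin_upd c :
    lin (is_pair_e h k.+1)
      (fun w => (dist 0 k.+1 (fun i => pickle (h i, upd c i)) w)%:R).
  by apply: lin_gen; exists (upd c).
have lin_upds := @lin_sum _ _ (iota 0 K) _ (fun c _ => lin_upd c).
apply: (lin_ext (lin_comb (t - K%:R) (lin_upd K) lin_upds)) => w.
have updE c : dist 0 k.+1 (fun i => pickle (h i, upd c i)) w =
    dist 0 k (fun i => pickle (h i, g i)) w &&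
    all (fun j => [&& h j == h k, w j == w k & g j == c] ==> false) (iota 0 k).
  apply/distP/andP => [Dw|[/distP Dw /allP Nw] i j].
    split; first apply/distP => i j ik jk ij /eqP.
      rewrite pickle_eq => /eqP[hij gij]; apply: Dw => //; try lia.
      by rewrite /upd hij; do 2!case: eqP => [?|_]; try lia; rewrite gij.
    apply/allP => j; rewrite mem_iota => jk.
    apply/implyP => /and3P[/eqP hj /eqP wj /eqP gj].
    have := Dw j k; rewrite wj eqxx; apply; try lia.
    by rewrite /upd eqxx hj; case: eqP => [?|_]; [lia|rewrite gj].
  move=> ik jk ij /eqP; rewrite pickle_eq /upd => /eqP[hij].
  have [ik1|ik1] := eqVneq i k; have [jk1|jk1] := eqVneq j k.
  - by rewrite ik1 jk1 eqxx in ij.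
  - move=> cg; have := Nw j; rewrite mem_iota => /(_ ltac:(lia)).
    by rewrite -cg eqxx -ik1 hij eqxx /= andbT implybF eq_sym.
  - move=> cg; have := Nw i; rewrite mem_iota => /(_ ltac:(lia)).
    by rewrite -cg eqxx -jk1 hij eqxx /= andbT implybF.
  - by move=> gij; apply: Dw; rewrite ?hij ?gij //; lia.
rewrite updE; under eq_bigr => c _ do rewrite updE.
have [Dw|] := boolP (dist 0 k _ w); last first.
  by rewrite big1 //= mulr0 addr0 mul0r.
rewrite /= mul1r; have -> : all (fun j => [&& h j == h k, w j == w k & g j == K]
    ==> false) (iota 0 k).
  apply/allP => j; rewrite mem_iota => jk; apply/implyP => /and3P[_ _ /eqP gj].
  by have := gK j jk; rewrite gj ltnn.
(* The labels ruled out by [w]; they are distinct because equal letters never share a block. *)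
pose A := [seq g j | j <- iota 0 k & (h j == h k) && (w j == w k)].
have uA : uniq A.
  rewrite map_inj_in_uniq ?filter_uniq ?iota_uniq // => i j.
  rewrite !mem_filter !mem_iota => /andP[/andP[/eqP hi /eqP wi] ik].
  move=> /andP[/andP[/eqP hj /eqP wj] jk] gij; apply/eqP.
  apply/negPn/negP => ij; have /distP/(_ i j) := Dw.
  by rewrite ik jk ij hi hj gij wi wj eqxx => /(_ isT isT isT erefl).
have sA : size A = rank h w k by rewrite size_map size_filter.
have -> : \sum_(c <- iota 0 K) (all (fun j => [&& h j == h k, w j == w k
    & g j == c] ==> false) (iota 0 k))%:R = \sum_(c <- iota 0 K) (c \notin
      A)%:R :> rat.
  apply: eq_bigr => c _; congr (_%:R); congr nat_of_bool; apply/allP/idP.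
    move=> Nw; apply/mapP => -[j]; rewrite mem_filter => /andP[/andP[hj wj] jk]
      cj.
    by have := Nw j jk; rewrite hj wj cj eqxx.
  move=> cA j jk; apply/implyP => /and3P[hj wj /eqP gj]; case/negP: cA.
  by apply/mapP; exists j; rewrite // mem_filter hj wj.
rewrite mulr1.
have -> : \sum_(c <- iota 0 K) (c \notin A)%:R = K%:R - (size A)%:R :> rat.
  have -> : size A = (\sum_(c <- iota 0 K) (c \in A))%N.
    rewrite -big_mkcond /= sum1_count -size_filter; apply: perm_size.
    apply: uniq_perm; rewrite ?filter_uniq ?iota_uniq // => c.
    rewrite mem_filter mem_iota /=; case: (boolP (c \in A)) => //= /mapP[j].
    by rewrite mem_filter mem_iota => /andP[_ jk] ->; rewrite gK.
  have {2}-> : K = (\sum_(c <- iota 0 K) 1)%N by rewrite sum1_size size_iota.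
  rewrite !natr_sum -sumrB; apply: eq_bigr => c _.
  by case: (c \in A); rewrite ?subrr ?subr0.
by rewrite sA; ring.
Qed.

Definition const_on (n : nat) (h w : nat -> nat) : bool :=
  all (fun i => all (fun j => (h i == h j) ==> (w i == w j)) (iota 0 n))
    (iota 0 n).

Lemma const_onP n h w :
  reflect (forall i j, (i < n)%N -> (j < n)%N -> h i = h j -> w i = w j)
          (const_on n h w).
Proof.
apply: (iffP allP) => [hw i j ni nj hij|hw i].
  have := hw i; rewrite mem_iota => /(_ ni)/allP/(_ j).
  by rewrite mem_iota hij eqxx => /(_ nj) /eqP.
rewrite mem_iota => ni; apply/allP => j; rewrite mem_iota => nj.
by apply/implyP => /eqP hij; apply/eqP/hw.
Qed.

(** Factors are multiplied in one at a time: the one at [i] involves no position after [i]. The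
    refinement of [h] is kept until the end, as [is_pair_e_rank] relies on it. *)
Lemma lin_prod_rank h (t : nat -> rat) n :
  lin (is_e n) (fun w => \prod_(i < n) (t i - (rank h w i)%:R)).
Proof.
suff L : lin (is_pair_e h n) (fun w => \prod_(i < n) (t i - (rank h w i)%:R)).
  have /lin_mul := L; move=> /(_ (is_e n) (fun=> 1)) L'.
  apply: lin_ext (L' _) _ => [f [g ->]|w]; last by rewrite mulr1.
  apply: (@lin_ext _ (fun w => (dist 0 n (fun i => pickle (h i, g i)) w)%:R)).
    by apply: lin_gen; exists (fun i => pickle (h i, g i)).
  by move=> w; rewrite mulr1.
elim: n => [|n IHn].
  apply: (@lin_ext _ (fun w => (dist 0 0 (fun i => pickle (h i, i)) w)%:R)).
    by apply: lin_gen; exists id.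
  by move=> w; rewrite big_ord0.
apply: lin_ext (lin_mul (fun f => @is_pair_e_rank h n (t n) f) IHn) _ => w.
by rewrite big_ord_recr.
Qed.

(* In prod_(i < n) (t i - rank h w i), take t i = 1 at the first position of
   each class of h (where the rank is 0) and t i = 0 elsewhere: the product
   vanishes unless w is constant on the classes of h, and then it only depends on h. *)
Lemma lin_const_on n h : lin (is_e n) (fun w => (const_on n h w)%:R).
Proof.
pose first i := all (fun j => h j != h i) (iota 0 i).
pose t i : rat := (first i)%:R.
pose C := \prod_(i < n) (t i - (rank h h i)%:R).
have rank_hh i : rank h h i = count (fun j => h j == h i) (iota 0 i).
  by apply: eq_count => j; rewrite andbb.
have C0 : C != 0.
  apply/prodf_neq0 => i _; rewrite rank_hh /t.
  case: (boolP (first i)) => fi.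
    rewrite (_ : count _ _ = 0%N) ?subr0 ?oner_eq0 //.
    by apply/eqP; rewrite -leqn0 leqNgt -has_count -all_predC.
  rewrite sub0r oppr_eq0 pnatr_eq0 -lt0n -has_count.
  by rewrite -[has _ _]negbK -all_predC.
apply: lin_ext (lin_scale C^-1 (lin_prod_rank h t n)) _ => w.
have [/const_onP hw|hw] := boolP (const_on n h w).
  rewrite (_ : \prod_(i < n) _ = C) ?mulVf //.
  apply: eq_bigr => i _; rewrite (_ : rank h w i = rank h h i) //.
  apply: eq_in_count => j.
  rewrite mem_iota /= => ji; rewrite andbb; case: eqP => //= hij.
  by rewrite (hw j i (ltn_trans ji (ltn_ord i)) (ltn_ord i) hij) eqxx.
have [/existsP[i /eqP i0]|] := boolP [exists i : 'I_n, t i - (rank h w i)%:R ==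
  0].
  by rewrite (bigD1 i) //= i0 mul0r mulr0.
rewrite negb_exists => /forallP t0; case/negP: hw.
have key i : (i < n)%N -> ~~ first i ->
    exists2 j, (j < i)%N & h j = h i /\ w j = w i.
  move=> ni fi; have := t0 (Ordinal ni).
  rewrite /t (negPf fi) sub0r oppr_eq0 pnatr_eq0 -lt0n -has_count.
  case/hasP => j; rewrite mem_iota => /= ji /andP[/eqP hj /eqP wj].
  by exists j.
(* Following [key] downwards ends at the first position of the class, which carries the same letter
   as [i]. *)
have low i : (i < n)%N -> exists j, [/\ (j <= i)%N, first j, h j = h i & w j =
  w i].
  elim/ltn_ind: i => i IHi ni; have [fi|fi] := boolP (first i).
    by exists i.
  have [j ji [<- <-]] := key i ni fi.
  have [k [kj fk <- <-]] := IHi j ji (ltn_trans ji ni).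
  by exists k; split=> //; lia.
apply/const_onP => i j ni nj hij.
have [i' [_ fi hi <-]] := low i ni; have [j' [_ fj hj <-]] := low j nj.
suff -> : i' = j' by [].
have hij' : h i' = h j' by rewrite hi hj.
have [ij|ij|//] := ltngtP i' j'.
  by have /allP/(_ i') := fj; rewrite mem_iota ij hij' eqxx => /(_ isT).
by have /allP/(_ j') := fi; rewrite mem_iota ij hij' eqxx => /(_ isT).
Qed.

(** Induction on the inequations: the indicator of [w i != w j] is 1 minus that of [w i = w j], and
    the equation is absorbed by merging the class of [i] into that of [j]. *)
Lemma lin_const_on_neq n h (L : seq (nat * nat)) :
  all (fun x => (x.1 < n)%N && (x.2 < n)%N) L ->
  lin (is_e n)
    (fun w => (const_on n h w && all (fun x => w x.1 != w x.2) L)%:R).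
Proof.
elim: L h => [|[i j] L IHL] h /=.
  by move=> _; apply: lin_ext (lin_const_on n h) _ => w; rewrite andbT.
case/andP=> /andP[ni nj] nL.
pose h' k := if h k == h i then h j else h k.
apply: lin_ext (lin_comb (-1) (IHL h' nL) (IHL h nL)) _ => w.
have -> : const_on n h' w = const_on n h w && (w i == w j).
  apply/const_onP/andP => [hw|[/const_onP hw /eqP wij] k k' nk nk'].
    split; last by apply/eqP/hw; rewrite // /h' eqxx; case: eqP.
    by apply/const_onP => k k' nk nk' hk; apply: hw; rewrite // /h' hk.
  rewrite /h'; case: eqP => [hk|_]; case: eqP => [hk'|_].
  - by move=> _; apply: hw; rewrite // hk hk'.
  - by move/(hw _ _ nj nk') <-; rewrite -wij; apply: hw.
  - by move/(hw _ _ nk nj) ->; rewrite -wij; apply: hw.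
  - exact: hw.
by case: const_on; case: eqP; case: all; rewrite /= ?mulr1 ?mulr0 ?addr0 ?subrr
   ?add0r ?addNr.
Qed.

(** This is the monomial basis: equalities come from [const_on], inequalities from the list of all
    pairs that [g] separates. *)
Lemma lin_same_kernel n g : lin (is_e n) (fun w => (same_kernel n g w)%:R).
Proof.
pose L := [seq x <- [seq (i, j) | i <- iota 0 n, j <- iota 0 n] | g x.1 != g
  x.2].
have nL : all (fun x => (x.1 < n)%N && (x.2 < n)%N) L.
  apply/allP => -[i j]; rewrite mem_filter => /andP[_ /allpairsP[[i' j']]].
  by rewrite !mem_iota /= => -[ni nj [-> ->]]; rewrite ni nj.
apply: lin_ext (lin_const_on_neq g nL) _ => w; congr (_%:R); congr nat_of_bool.
apply/andP/same_kernelP => [[/const_onP gw /allP neq] i j ni nj|gw].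
  apply/eqP/eqP => [/gw ->//|wij]; apply/eqP/negPn/negP => gij.
  have := neq (i, j); rewrite mem_filter /= gij wij eqxx => /implyP.
  by rewrite implybF => /negP[]; apply/allpairsP; exists (i, j);
    rewrite !mem_iota.
split; first by apply/const_onP => i j ni nj /eqP; rewrite gw // => /eqP.
apply/allP => -[i j]; rewrite mem_filter => /andP[gij /allpairsP[[i' j']]].
by rewrite !mem_iota /= => -[ni nj [ii jj]]; move: gij; rewrite ii jj gw.
Qed.

(** Sum over the finitely many kernels, represented by functions into ['I_N.+1]. Several functions
    share a kernel, so each term is divided by their number [M], which depends on the kernel
    only. *)
Lemma lin_kernel_inv N f : kernel_inv N.+1 f -> lin (is_e N.+1) f.
Proof.
move=> fi; pose wd (g : {ffun 'I_N.+1 -> 'I_N.+1}) (i : nat) : nat := g (inord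
  i).
pose M w := \sum_g (same_kernel N.+1 (wd g) w)%:R : rat.
have M0 w : M w != 0.
  (* Replacing each letter by the index of its first occurrence represents the kernel of [w]. *)
  pose g := [ffun i : 'I_N.+1 => inord (index (w i) [seq w j | j <- iota 0
    N.+1])] :
    {ffun 'I_N.+1 -> 'I_N.+1}.
  have gw : same_kernel N.+1 (wd g) w.
    have mw i : (i < N.+1)%N -> w i \in [seq w j | j <- iota 0 N.+1].
      by move=> ni; apply: map_f; rewrite mem_iota.
    apply/same_kernelP => i j ni nj; rewrite /wd !ffunE.
    rewrite !(inordK ni, inordK nj).
    rewrite !inordK; do ?by rewrite -[X in (_ < X)%N](size_iota 0 N.+1)
      -(size_map w) index_mem mw.
    apply/eqP/eqP => [eq_ij|->//].
    by rewrite -(nth_index 0%N (mw i ni)) eq_ij nth_index ?mw.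
  rewrite /M (bigD1 g) //= gw; apply: lt0r_neq0.
  by rewrite ltr_pwDl // sumr_ge0 // => *; rewrite ler0n.
pose F g w := f (wd g) / M (wd g) * (same_kernel N.+1 (wd g) w)%:R.
apply: (@lin_ext _ (fun w => \sum_(g <- index_enum _) F g w)).
  by apply: lin_sum => g _; apply/lin_scale/lin_same_kernel.
move=> w; rewrite (eq_bigr (fun g => f w / M w * (same_kernel N.+1 (wd g)
  w)%:R)).
  by rewrite -mulr_sumr mulfVK.
move=> g _; rewrite /F; case: (boolP (same_kernel _ _ _)) => [gw|];
  rewrite ?mulr0 //.
congr (_ / _ * _); first exact: fi.
by apply: eq_bigr => g' _; rewrite ![same_kernel _ (wd g') _]same_kernel_sym
  (same_kernel_trans _ gw).
Qed.

(** * Stability of invariance under products and longer words *)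

Lemma kernel_invM n (f g : series) :
  kernel_inv n f -> kernel_inv n g -> kernel_inv n (fun w => f w * g w).
Proof. by move=> fi gi w w' ww'; rewrite (fi w w') ?(gi w w'). Qed.

Lemma same_kernel_le m n w w' :
  (m <= n)%N -> same_kernel n w w' -> same_kernel m w w'.
Proof.
move=> mn /same_kernelP ww'; apply/same_kernelP => i j mi mj.
by apply: ww'; apply: leq_trans mn.
Qed.

Lemma kernel_inv_le m n f : (m <= n)%N -> kernel_inv m f -> kernel_inv n f.
Proof. by move=> mn fi w w' /(same_kernel_le mn)/fi. Qed.

Lemma kernel_inv_eq n i j :
  (i < n)%N -> (j < n)%N -> kernel_inv n (fun w => (w i == w j)%:R).
Proof. by move=> ni nj w w' /same_kernelP ww'; rewrite ww'. Qed.

Lemma kernel_inv_dist a n g : kernel_inv n (fun w => (dist a n g w)%:R).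
Proof.
move=> w w' /same_kernelP ww'; congr (_%:R); congr nat_of_bool.
apply/distP/distP => gw i j /andP[ai ni] /andP[aj nj] ij gij;
  by have := gw i j; rewrite ww' // ai aj ni nj; apply.
Qed.

(** * Null series and the repetition of the last letter *)

(** The involution fixes every index from [N] on, not only the last position, so that letters
    appended later are not disturbed. *)
Definition is_swap_diff (N : nat) (F : series) : Prop :=
  exists f s, [/\ kernel_inv N.+1 f, involutive s,
    forall i, (i < N)%N -> (s i < N)%N, forall i, (N <= i)%N -> s i = i
    & F = fun w => f w - f (w \o s)].

(* Here N is the index of the last letter of words of length N.+1. *)
Definition null (N : nat) : series -> Prop := lin (is_swap_diff N).

(** The involutions fix [N] and [N.+1], so they leave [phi] alone: a swap difference times [phi] is
    again a swap difference, now with last position [N.+1]. *)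
Lemma null_mul N f phi :
  kernel_inv N.+2 phi ->
  (forall s w, s N = N -> s N.+1 = N.+1 -> phi (w \o s) = phi w) ->
  null N f -> null N.+1 (fun w => f w * phi w).
Proof.
move=> phii phis; apply: lin_mul => _ [g [s [gi ss sN Ns ->]]].
pose gphi w := g w * phi w.
apply: (@lin_ext _ (fun w => gphi w - gphi (w \o s))).
  apply: lin_gen; exists gphi, s; split=> // [|i iN|i Ni].
  - by apply: kernel_invM phii; apply: kernel_inv_le gi.
  - have [{}iN|Ni] := ltnP i N; first by apply: leq_trans (sN i iN) _.
    by rewrite Ns.
  - by rewrite Ns // ltnW.
by move=> w; rewrite /gphi phis ?Ns // mulrBl.
Qed.

Lemma null_widen N f : null N f -> null N.+1 f.
Proof.
move=> fN; apply: (@lin_ext _ (fun w => f w * 1)) => [|w];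
  last by rewrite mulr1.
exact: null_mul fN.
Qed.

Lemma null_up N f :
  null N f -> null N.+1 (fun w => f w * (w N.+1 == w N)%:R).
Proof.
apply: null_mul => [|s w /= -> -> //].
by apply: kernel_inv_eq.
Qed.

Definition swap (j k i : nat) : nat :=
  if i == j then k else if i == k then j else i.

Lemma swapK j k : involutive (swap j k).
Proof.
move=> i; rewrite /swap.
have [->|ij] := eqVneq i j; first by rewrite eqxx; case: eqP.
have [->|ik] := eqVneq i k; first by rewrite eqxx.
by rewrite (negPf ij) (negPf ik).
Qed.

(** Exchanging [N] with [j] in [B] is allowed since [N.+1] is now last; it fixes [f] and turns the
    condition [w N.+1 = w N] into [w N.+1 = w j]. Summing over [B], where the letters are distinct,
    gives the indicator that [w N.+1] occurs on [B]. *)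
Lemma null_induction N f (B : seq nat) :
  kernel_inv N.+1 f -> uniq B -> N \in B -> {in B, forall j, (j <= N)%N} ->
  {in B, forall j w, f (w \o swap j N) = f w} ->
  (forall w, f w != 0 -> uniq (map w B)) ->
  null N.+1 (fun w => f w * (w N.+1 == w N)%:R
    - (size B)%:R^-1 * (f w - f w * (w N.+1 \notin map w B)%:R)).
Proof.
move=> fi uB NB BN fB fu.
have B0 : (size B)%:R != 0 :> rat by rewrite pnatr_eq0 -lt0n;
  case: B NB {uB BN fB fu}.
pose g w := f w * (w N.+1 == w N)%:R.
pose F := fun w => \sum_(j <- B) (size B)%:R^-1 * (g w - g (w \o swap j N)).
apply: (@lin_ext _ F).
  apply: lin_sum => j jB; apply: lin_scale; apply: lin_gen.
  have jN := BN j jB.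
  exists g, (swap j N); split=> // [||i iN|i Ni].
  - apply: kernel_invM; first by apply: kernel_inv_le fi.
    by apply: kernel_inv_eq.
  - exact: swapK.
  - by rewrite /swap; case: eqP => // _; case: eqP => // _; rewrite ltnS.
  - by rewrite /swap; do 2?case: eqP => ?; lia.
move=> w; rewrite /F -mulr_sumr sumrB big_const_seq count_predT iter_addr addr0.
have [f0|f0] := eqVneq (f w) 0.
  rewrite big1_seq => [|j /andP[_ jB]]; rewrite /g ?fB // f0 !mul0r ?mul0rn
    ?subrr //.
  by rewrite mulr0 subrr.
have -> : \sum_(j <- B) g (w \o swap j N) = f w * (w N.+1 \in map w B)%:R.
  rewrite -count_uniq_mem ?fu // count_map -sum1_count natr_sum mulr_sumr
    [RHS]big_mkcond.
  apply: eq_big_seq => j jB; rewrite /g fB //=.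
  have -> : swap j N N.+1 = N.+1 by have := BN j jB; rewrite /swap;
    do 2?case: eqP => ?; lia.
  have -> : swap j N N = j by rewrite /swap eqxx; case: eqP.
  by rewrite eq_sym; case: eqP; rewrite ?mulr0.
rewrite -[g w *+ _]mulr_natr -/(g w) mulrBr mulrCA mulVf // mulr1.
by case: (_ \in _); rewrite /= ?mulr0 ?mulr1 ?subr0 ?subrr ?mulr0 ?subr0.
Qed.

(** * Compositions and block weights *)

Definition inj_on (a n : nat) (w : nat -> nat) : bool :=
  uniq (map w (index_iota a n)).

Lemma inj_onE a n w : inj_on a n w = dist a n (fun=> 0%N) w.
Proof.
apply/idP/distP => [uw i j ai aj ij _|dw].
  apply/eqP => wij; case/eqP: ij.
  have /uniqP/(_ (i - a) (j - a))%N := uw => /(_ 0%N).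
  rewrite !inE size_map size_iota !(nth_map 0%N) ?size_iota; try lia.
  rewrite !nth_iota ?subnKC; try lia.
rewrite /inj_on map_inj_in_uniq ?iota_uniq // => i j.
rewrite !mem_index_iota => ai aj wij; apply/eqP/negPn/negP => ij.
by have := dw i j ai aj ij erefl; rewrite wij eqxx.
Qed.

Lemma inj_onS a n w : (a <= n)%N ->
  inj_on a n.+1 w = inj_on a n w && (w n \notin map w (index_iota a n)).
Proof.
by move=> an; rewrite /inj_on /index_iota subSn // -addn1 iotaD map_cat subnKC
  //=
  cats1 rcons_uniq andbC.
Qed.

(** [closed_wt] weights a completed block of size [k], the other two the last block of a path or a
    cycle. For [k > 1], [path_wt k] is [1/(k-1)!] and [cycle_wt k] is [1/(k-2)!]; at [k = 1] they
    are 1 and 0. *)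
Definition closed_wt (k : nat) : rat := (k%:R - 1) / k`!%:R.
Definition path_wt (k : nat) : rat := k%:R / k`!%:R.
Definition cycle_wt (k : nat) : rat := k%:R * (k%:R - 1) / k`!%:R.

(* The fuel only makes the recursion on a < n structural. *)
Fixpoint comp_rec (fuel n : nat) : series :=
  fun w => if n is n'.+1 then
    if fuel is fuel'.+1 then
      \sum_(a < n) closed_wt (n - a) * (comp_rec fuel' a w * (inj_on a n w)%:R)
    else 0
  else 1.

(** The series [Z_n], unfolded from its last block, which occupies the positions [a], ...,
    [n - 1]. *)
Definition comp_series (n : nat) : series := comp_rec n n.

Lemma comp_recE fuel n w :
  (n <= fuel)%N -> comp_rec fuel n w = comp_series n w.
Proof.
rewrite /comp_series; elim/ltn_ind: n fuel => -[|n] IHn [|fuel] //= nf.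
by apply: eq_bigr => a _; have an := ltn_ord a;
  rewrite IHn ?[comp_rec n _ _]IHn //; lia.
Qed.

Lemma comp_series0 w : comp_series 0 w = 1.
Proof. by []. Qed.

Lemma comp_seriesS n w : comp_series n.+1 w =
  \sum_(a < n.+1) closed_wt (n.+1 - a) * (comp_series a w * (inj_on a n.+1
    w)%:R).
Proof.
rewrite {1}/comp_series /=; apply: eq_bigr => a _.
by rewrite (@comp_recE n) // -ltnS.
Qed.

Lemma eq_comp_series n w w' :
  (forall i, (i < n)%N -> w i = w' i) -> comp_series n w = comp_series n w'.
Proof.
elim/ltn_ind: n => -[|n] IHn ww' //; rewrite !comp_seriesS.
apply: eq_bigr => a _; congr (_ * (_ * _%:R)).
  by apply: IHn => // i ia; apply: ww'; apply: ltn_trans (ltn_ord a).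
congr (nat_of_bool (uniq _)); apply/eq_in_map => i.
by rewrite mem_index_iota => /andP[_ ni]; apply: ww'.
Qed.

Lemma kernel_inv_comp_series n : kernel_inv n (comp_series n).
Proof.
elim/ltn_ind: n => -[|n] IHn w w' ww' //; rewrite !comp_seriesS.
apply: eq_bigr => a _; rewrite !inj_onE (kernel_inv_dist _ _ ww').
by rewrite (IHn a (ltn_ord a) w w') //; apply: same_kernel_le ww'; apply: ltnW.
Qed.

Definition run (a n : nat) : series :=
  fun w => comp_series a w * (inj_on a n w)%:R.

(** Case [B = {a, ..., N}] of [null_induction]: the factor [comp_series a] sees only letters before
    [a], hence is fixed by the exchanges. *)
Lemma null_run a N : (a <= N)%N ->
  null N.+1 (fun w => run a N.+1 w * (w N.+1 == w N)%:R
    - (N.+1 - a)%:R^-1 * (run a N.+1 w - run a N.+2 w)).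
Proof.
move=> aN; have := @null_induction N (run a N.+1) (index_iota a N.+1).
rewrite size_iota iota_uniq mem_index_iota aN ltnSn => H.
apply: lin_ext (H _ _ _ _ _ _) _ => // [w w' ww'|j|j|w|w].
- rewrite /run !inj_onE (kernel_inv_dist _ _ ww') (kernel_inv_comp_series _ (w'
    := w')) //.
  by apply: same_kernel_le ww'; apply: leqW.
- by rewrite mem_index_iota => /andP[_].
- rewrite mem_index_iota => /andP[aj jN] w; rewrite /run; congr (_ * _%:R).
    by apply: eq_comp_series => i /= ia; rewrite /swap; do 2?case: eqP => ?;
      try lia.
  congr nat_of_bool; rewrite !inj_onE; apply/distP/distP => dw i k ai ak ik _.
    have := dw (swap j N i) (swap j N k); rewrite /= !swapK; apply=> //.
    + by rewrite /swap; do 2?case: eqP => ?; lia.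
    + by rewrite /swap; do 2?case: eqP => ?; lia.
    + by rewrite (can_eq (@swapK j N)).
  apply: dw => //.
  + by rewrite /swap; do 2?case: eqP => ?; lia.
  + by rewrite /swap; do 2?case: eqP => ?; lia.
  + by rewrite (can_eq (@swapK j N)).
- by rewrite /run mulf_eq0 negb_or => /andP[_]; rewrite pnatr_eq0 eqb0 negbK.
- congr (_ - _ * (_ - _)); rewrite /run (@inj_onS a N.+1) ?leqW // -mulrA
    -natrM.
  by congr (_ * _%:R); case: inj_on; rewrite ?mul1n ?mul0n.
Qed.

Lemma run_last N w : run N.+1 N.+2 w = comp_series N.+1 w.
Proof. by rewrite /run /inj_on /index_iota subSnn mulr1. Qed.

Lemma fact_neq0 k : k`!%:R != 0 :> rat.
Proof. by rewrite pnatr_eq0 -lt0n fact_gt0. Qed.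

Lemma nat1_neq0 k : 1 + k%:R != 0 :> rat.
Proof. by rewrite nat1r pnatr_eq0. Qed.

Lemma closed_wt_path k : (0 < k)%N -> path_wt k / k%:R = path_wt k - closed_wt
  k.
Proof.
case: k => // k _; rewrite /path_wt /closed_wt.
by field; rewrite ?fact_neq0 ?nat1_neq0.
Qed.

Lemma path_wtS k : (0 < k)%N -> path_wt k.+1 = path_wt k / k%:R.
Proof.
case: k => // k _; rewrite /path_wt factS natrM.
have k1 : k.+2%:R != 0 :> rat by rewrite pnatr_eq0.
by rewrite invfM mulrA divff // mul1r mulrAC divff ?mul1r // pnatr_eq0.
Qed.

Lemma cycle_wt_closed k : (0 < k)%N -> cycle_wt k / k%:R = closed_wt k.
Proof.
case: k => // k _; rewrite /cycle_wt /closed_wt.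
by field; rewrite ?fact_neq0 ?nat1_neq0.
Qed.

Lemma cycle_wtS k : cycle_wt k.+1 = path_wt k.
Proof.
rewrite /cycle_wt /path_wt factS natrM.
by field; rewrite ?fact_neq0 ?nat1_neq0.
Qed.

Lemma path_wt_cycle k : (0 < k)%N -> path_wt k.+1 + closed_wt k = cycle_wt k.+1.
Proof.
by move=> k0; rewrite path_wtS // closed_wt_path // cycle_wtS; ring.
Qed.

(** * Chromatic series of paths and cycles *)

Definition path_col (N : nat) (w : nat -> nat) : bool :=
  all (fun i => w i != w i.+1) (iota 0 N).

Definition cycle_col (N : nat) (w : nat -> nat) : bool :=
  path_col N w && (w N != w 0).

Lemma path_colS N w : path_col N.+1 w = path_col N w && (w N != w N.+1).
Proof. by rewrite /path_col -[X in iota 0 X]addn1 iotaD all_cat /= andbT. Qed.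

Lemma kernel_inv_path_col N : kernel_inv N.+1 (fun w => (path_col N w)%:R).
Proof.
move=> w w' /same_kernelP ww'; congr (_%:R); congr nat_of_bool;
  apply: eq_in_all => i.
by rewrite mem_iota => iN; rewrite ww' //; lia.
Qed.

Lemma kernel_inv_cycle_col N : kernel_inv N.+1 (fun w => (cycle_col N w)%:R).
Proof.
move=> w w' ww'; rewrite /cycle_col; have /same_kernelP -> // := ww'.
have /eqP := kernel_inv_path_col ww'.
by rewrite eqr_nat; case: path_col; case: path_col.
Qed.

Definition path_sum (N : nat) : series :=
  fun w => \sum_(a < N.+1) path_wt (N.+1 - a) * run a N.+1 w.

Definition cycle_sum (N : nat) : series :=
  fun w => \sum_(a < N.+1) cycle_wt (N.+1 - a) * run a N.+1 w.

(** The run reaches one position further than its weight indicates: the new letter joins the last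
    block without changing the weight. *)
Definition closed_sum (N : nat) : series :=
  fun w => \sum_(a < N.+1) closed_wt (N.+1 - a) * run a N.+2 w.

(** Naming the null series of [null_run] turns the congruences below into exact identities that
    [ring] can check. *)
Definition run_defect (a N : nat) : series := fun w =>
  run a N.+1 w * (w N.+1 == w N)%:R
    - (N.+1 - a)%:R^-1 * (run a N.+1 w - run a N.+2 w).

Lemma null_run_defects (c : nat -> rat) N :
  null N.+1 (fun w => \sum_(a < N.+1) c a * run_defect a N w).
Proof.
apply: lin_sum => a _; apply: lin_scale; apply: null_run.
by rewrite -ltnS.
Qed.

(** Let [k = N.+1 - a]. On the right, [run a N.+2] has coefficient [path_wt k / k = path_wt k.+1],
    and [run a N.+1] has [path_wt k - path_wt k / k = closed_wt k]; the latter terms add up to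
    [comp_series N.+1], the summand [a = N.+1] on the left. *)
Lemma path_sumS N w : path_sum N.+1 w =
  path_sum N w - path_sum N w * (w N.+1 == w N)%:R
  + \sum_(a < N.+1) path_wt (N.+1 - a) * run_defect a N w.
Proof.
rewrite {1}/path_sum big_ord_recr /= subSnn run_last comp_seriesS /path_sum.
rewrite mulr_suml -sumrB -big_split mulr_sumr -big_split /=.
apply: eq_bigr => a _; rewrite -/(run a N.+1 w) /run_defect.
have k0 : (0 < N.+1 - a)%N by rewrite subn_gt0.
have -> : (N.+2 - a = (N.+1 - a).+1)%N by rewrite subSn // ltnW.
have E := closed_wt_path k0; rewrite path_wtS //.
have -> : path_wt 1 = 1 by [].
have -> : closed_wt (N.+1 - a) =
  path_wt (N.+1 - a) - path_wt (N.+1 - a) / (N.+1 - a)%:R by rewrite E; ring.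
by ring.
Qed.

(** Deletion-contraction of the last edge, matched with [path_sumS]. *)
Lemma null_path N : null N (fun w => (path_col N w)%:R - path_sum N w).
Proof.
elim: N => [|N IHN].
  apply: lin_ext (lin_zero _) _ => w.
  by rewrite /path_sum big_ord1 /path_wt /run /inj_on /= mulr1 subrr.
have D := null_run_defects (fun a => path_wt (N.+1 - a)) N.
apply: lin_ext (lin_comb (-1) (null_up IHN) (lin_comb (-1) D (null_widen IHN)))
  _.
move=> w; rewrite path_sumS path_colS [w N == _]eq_sym.
by case: path_col; case: eqP => _ /=; ring.
Qed.

(** The reversal of the positions up to [N] is a symmetry of the cycle, exchanges 0 and [N], and
    fixes [N.+1]. *)
Lemma null_cycle_reflect N : null N.+1 (fun w =>
  (cycle_col N w)%:R * (w N.+1 == w 0)%:R - (cycle_col N w)%:R * (w N.+1 == w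
    N)%:R).
Proof.
pose s i := if (i <= N)%N then (N - i)%N else i.
pose f w := (cycle_col N w)%:R * (w N.+1 == w 0)%:R : rat.
apply: (@lin_ext _ (fun w => f w - f (w \o s))).
  apply: lin_gen; exists f, s; split=> // [|i|i iN|i Ni].
  - apply: kernel_invM; last exact: kernel_inv_eq.
    exact: kernel_inv_le (@kernel_inv_cycle_col N).
  - rewrite /s; case: (leqP i N) => iN; last by rewrite leqNgt iN.
    by rewrite leq_subr subKn.
  - by rewrite /s; case: (leqP i N) => ?; lia.
  - by rewrite /s leqNgt Ni.
move=> w; rewrite /f; congr (_ - _).
have s0 : s 0%N = N by rewrite /s subn0.
have sN : s N = 0%N by rewrite /s leqnn subnn.
have sN1 : s N.+1 = N.+1 by rewrite /s ltnn.
rewrite /= s0 sN1; congr (_%:R * _); congr nat_of_bool;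
  rewrite /cycle_col /= s0 sN [w 0 == _]eq_sym.
have flip i : (i < N)%N ->
    [/\ s i = (N - i.+1).+1, s i.+1 = (N - i.+1)%N & (N - i.+1 < N)%N].
  by move=> iN; rewrite /s (ltnW iN) iN; split; lia.
congr (_ && _); apply/allP/allP => col i; rewrite mem_iota add0n => iN.
  have [_ _ jN] := flip i iN; have [s1 s2 _] := flip _ jN.
  have := col (N - i.+1)%N; rewrite mem_iota /= s1 s2 eq_sym => /(_ jN).
  by rewrite (_ : N - (N - i.+1).+1 = i)%N //; lia.
have [s1 s2 jN] := flip i iN; rewrite /= s1 s2 eq_sym.
by apply: col; rewrite mem_iota.
Qed.

(** The summand [comp_series N.+1] of the path cancels against the terms of weight
    [cycle_wt k / k = closed_wt k] from the defects; what remains is [path_wt k.+1 + closed_wt k =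
    cycle_wt k.+1]. *)
Lemma cycle_sumE N w : cycle_sum N.+1 w = path_sum N.+1 w
  - cycle_sum N w * (w N.+1 == w N)%:R
  + \sum_(a < N.+1) cycle_wt (N.+1 - a) * run_defect a N w.
Proof.
rewrite {1}/cycle_sum {1}/path_sum ![\sum_(a < N.+2) _]big_ord_recr /= subSnn
  run_last comp_seriesS.
rewrite /cycle_sum mulr_suml !mulr_sumr -!big_split -sumrB -big_split /=.
apply: eq_bigr => a _; rewrite -/(run a N.+1 w) /run_defect.
have k0 : (0 < N.+1 - a)%N by rewrite subn_gt0.
have -> : (N.+2 - a = (N.+1 - a).+1)%N by rewrite subSn // ltnW.
rewrite -path_wt_cycle // -cycle_wt_closed //.
have -> : path_wt 1 = 1 by [].
have -> : cycle_wt 1 = 0 by [].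
by ring.
Qed.

(** Deleting the closing edge leaves a path; contracting it leaves the shorter cycle with the letter
    at 0 repeated, and reflection moves the repetition to [N]. *)
Lemma null_cycle N : null N (fun w => (cycle_col N w)%:R - cycle_sum N w).
Proof.
elim: N => [|N IHN].
  (* The cycle on one vertex is a loop without proper colorings, in accordance with
     [cycle_wt 1 = 0]. *)
  apply: lin_ext (lin_zero _) _ => w.
  by rewrite /cycle_sum big_ord1 /cycle_col eqxx /= mul0r subrr.
have D := null_run_defects (fun a => cycle_wt (N.+1 - a)) N.
have R := null_cycle_reflect N.
have P := null_path N.+1.
apply: lin_ext (lin_comb (-1) (null_up IHN) (lin_comb (-1) D (lin_comb (-1) R
  P))) _.
move=> w; rewrite cycle_sumE /cycle_col path_colS [w N == w N.+1]eq_sym.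
case: path_col; rewrite /= ?mul0r; last by ring.
have [->|n] := eqVneq (w N) (w 0); first by case: (w N.+1 == w 0) => /=; ring.
have [->|_] := eqVneq (w N.+1) (w 0).
  by rewrite [w 0 == w N]eq_sym (negPf n) /=; ring.
by case: (w N.+1 == w N) => /=; ring.
Qed.

(** * Attaching the triangle *)

Lemma cycle_sum_up N w : cycle_sum N w * (w N.+1 == w N)%:R =
  comp_series N.+1 w - closed_sum N w
  + \sum_(a < N.+1) cycle_wt (N.+1 - a) * run_defect a N w.
Proof.
rewrite comp_seriesS /cycle_sum /closed_sum mulr_suml -sumrB -big_split /=.
apply: eq_bigr => a _; rewrite -/(run a N.+1 w) /run_defect.
by rewrite -cycle_wt_closed ?subn_gt0 //; ring.
Qed.

(** Since [w N != w 0] on the cycle, at most one of the two new edges is violated. By reflection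
    both violations cost the same, and [cycle_sum_up] evaluates that cost. *)
Lemma null_triangle N : null N.+1 (fun w =>
  (cycle_col N w && (w N.+1 != w 0) && (w N.+1 != w N))%:R
  - (\sum_(a < N.+1) (cycle_wt (N.+1 - a) - closed_wt (N.+1 - a) *+ 2)
       * run a N.+1 w + closed_sum N w *+ 2)).
Proof.
have D := null_run_defects (fun a => cycle_wt (N.+1 - a)) N.
have R := null_cycle_reflect N.
have C := null_cycle N.
apply: lin_ext (lin_comb (-2) D (lin_comb (-1) R
  (lin_comb (-2) (null_up C) (null_widen C)))) _ => w.
rewrite mulrBl cycle_sum_up.
have -> : \sum_(a < N.+1) (cycle_wt (N.+1 - a) - closed_wt (N.+1 - a) *+ 2)
    * run a N.+1 w = cycle_sum N w - comp_series N.+1 w *+ 2.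
  rewrite comp_seriesS /cycle_sum -sumrMnl -sumrB; apply: eq_bigr => a _.
  by rewrite -/(run a N.+1 w); ring.
rewrite /cycle_col; case: path_col; rewrite /= ?mul0r; last by ring.
have [->|n] := eqVneq (w N) (w 0); first by case: (w N.+1 == w 0) => /=; ring.
have [->|_] := eqVneq (w N.+1) (w 0).
  by rewrite [w 0 == w N]eq_sym (negPf n) /=; ring.
by case: (w N.+1 == w N) => /=; ring.
Qed.

(** * Positivity modulo null series *)

(** The convex cone spanned by the e-series, enlarged by all null series, whose class coefficients
    vanish. *)
Inductive epos (N : nat) : series -> Prop :=
| epos_null f : null N f -> epos N f
| epos_e g : epos N (fun w => (dist 0 N.+1 g w)%:R)
| epos_comb a f g :
    0 <= a -> epos N f -> epos N g -> epos N (fun w => a * f w + g w)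
| epos_ext f g : epos N f -> f =1 g -> epos N g.

Lemma epos_sum N (I : Type) (r : seq I) (c : I -> rat) (F : I -> series) :
  (forall i, 0 <= c i) -> (forall i, epos N (F i)) ->
  epos N (fun w => \sum_(i <- r) c i * F i w).
Proof.
move=> c0 FN; elim: r => [|i r IHr].
  by apply: epos_ext (epos_null (lin_zero _)) _ => w; rewrite big_nil.
by apply: epos_ext (epos_comb (c0 i) (FN i) IHr) _ => w; rewrite big_cons.
Qed.

Lemma epos_path N f :
  epos N f -> epos N.+1 (fun w => f w * (w N.+1 != w N)%:R).
Proof.
elim=> {f} [f fN|g|a f g a0 _ IHf _ IHg|f g _ IHf fg].
- apply: epos_null; apply: lin_ext (lin_comb (-1) (null_up fN) (null_widen fN))
    _.
  by move=> w; case: eqP => _ /=; ring.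
(* The block of the last position [N] in the kernel of [g]. *)
- pose B := [seq i <- iota 0 N.+1 | g i == g N].
  have memB j : (j \in B) = (j <= N)%N && (g j == g N).
    by rewrite mem_filter mem_iota andbC.
  (* The shift frees the label 0 for the new singleton. *)
  pose fresh i := if (i <= N)%N then (g i).+1 else 0%N.
  pose joined i := if (i <= N)%N then g i else g N.
  have freshE w : dist 0 N.+2 fresh w = dist 0 N.+1 g w.
    apply/distP/distP => dw i j iN jN ij gij; apply: dw; rewrite //; try lia.
    - by rewrite /fresh !ifT ?gij //; lia.
    - by move: gij ij; rewrite /fresh; case: (leqP i N) => ?;
        case: (leqP j N) => ?; lia.
    - by move: gij ij; rewrite /fresh; case: (leqP i N) => ?;
        case: (leqP j N) => ?; lia.
    - by move: gij ij; rewrite /fresh; case: (leqP i N) => ?;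
        case: (leqP j N) => ?; lia.
  have joinedE w : dist 0 N.+2 joined w =
      dist 0 N.+1 g w && (w N.+1 \notin map w B).
    apply/distP/andP => [dw|[/distP dw wB] i j].
      split; first apply/distP => i j iN jN ij gij.
        by apply: dw => //; rewrite /joined ?ifT //; lia.
      apply/mapP => -[j]; rewrite memB => /andP[jN /eqP gj] /eqP wj; move: wj.
      by apply/negP/dw; rewrite ?/joined ?ltnn ?jN ?gj //; lia.
    have notB k : (k <= N)%N -> g k = g N -> w N.+1 != w k.
      move=> kN gk; apply: contraNneq wB => ->.
      by apply: map_f; rewrite memB kN gk eqxx.
    rewrite /joined; case: (leqP i N) => iN; case: (leqP j N) => jN.
    - by move=> _ _; apply: dw.
    - by move=> _ ? _ gi; rewrite (_ : j = N.+1) 1?eq_sym; [apply: notB|lia].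
    - by move=> ? _ _ gj; rewrite (_ : i = N.+1); [apply: notB|lia].
    - by move=> ? ? ij; lia.
  have NB : N \in B by rewrite memB leqnn eqxx.
  have BN : {in B, forall j, (j <= N)%N} by move=> j; rewrite memB => /andP[].
  have uB : uniq B by rewrite filter_uniq // iota_uniq.
  have fB : {in B, forall j w,
      (dist 0 N.+1 g (w \o swap j N))%:R = (dist 0 N.+1 g w)%:R :> rat}.
    move=> j; rewrite memB => /andP[jN /eqP gj] w; congr (_%:R);
      congr nat_of_bool.
    have gs i : g (swap j N i) = g i.
      by rewrite /swap; case: eqP => [->|_]; [|case: eqP => [->|]].
    have sN i : (i < N.+1)%N -> (swap j N i < N.+1)%N.
      by rewrite /swap; do 2?case: eqP => ?; lia.
    apply/distP/distP => dw i k iN kN ik gik.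
      have := dw (swap j N i) (swap j N k); rewrite /= !swapK; apply.
      + exact: sN.
      + exact: sN.
      + by rewrite (can_eq (@swapK j N)).
      + by rewrite !gs.
    by apply: dw; rewrite ?gs ?(can_eq (@swapK j N)) //; apply: sN.
  have fu w : (dist 0 N.+1 g w)%:R != 0 :> rat -> uniq (map w B).
    rewrite pnatr_eq0 eqb0 negbK => /distP dw;
      rewrite map_inj_in_uniq // => i j.
    rewrite !memB => /andP[iN /eqP gi] /andP[jN /eqP gj] wij.
    apply/eqP/negPn/negP => ij.
    by have := dw i j iN jN ij; rewrite wij gi gj eqxx => /(_ erefl).
  have I := null_induction (@kernel_inv_dist 0 N.+1 g) uB NB BN fB fu.
  have b0 : (0 < size B)%N by case: B NB {memB BN uB fB fu I joinedE}.
  have c0 : 0 <= 1 - (size B)%:R^-1 :> rat.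
    by rewrite subr_ge0 invf_le1 ?ler1n // ltr0n.
  have c1 : 0 <= (size B)%:R^-1 :> rat by rewrite invr_ge0 ler0n.
  (* With [b = size B] and [e] the series of [g], deletion minus contraction is [e - (e - joined)/b
     = (1 - 1/b) fresh + (1/b) joined], as [fresh] and [g] give the same series. *)
  apply: epos_ext (epos_comb c0 (epos_e N.+1 fresh) (epos_comb c1
    (epos_e N.+1 joined) (epos_null (lin_scale (-1) I)))) _ => w.
  rewrite freshE joinedE; case: (dist 0 N.+1 g w) => /=; last by ring.
  by case: (w N.+1 == w N) => /=; ring.
- by apply: epos_ext (epos_comb a0 IHf IHg) _ => w; ring.
- by apply: epos_ext IHf _ => w; rewrite fg.
Qed.

Lemma closed_wt_ge0 k : (0 < k)%N -> 0 <= closed_wt k.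
Proof.
by move=> k0; rewrite /closed_wt divr_ge0 ?ler0n // subr_ge0 ler1n.
Qed.

(** Peel off the last block of the composition and absorb it into the partition: constraints on
    disjoint intervals form a single e-series, and the weights are nonnegative. *)
Lemma epos_comp_dist N a g : (a <= N.+1)%N ->
  epos N (fun w => comp_series a w * (dist a N.+1 g w)%:R).
Proof.
elim/ltn_ind: a g => -[|a] IHa g aN.
  by apply: epos_ext (epos_e N g) _ => w; rewrite comp_series0 mul1r.
(* Label 0 is the absorbed block; shifting [g] keeps it apart from the later ones. *)
pose g' i := if (i < a.+1)%N then 0%N else (g i).+1.
pose F (b : 'I_a.+1) w := comp_series b w * (dist b N.+1 g' w)%:R.
pose c (b : 'I_a.+1) := closed_wt (a.+1 - b).
have c0 b : 0 <= c b by rewrite closed_wt_ge0 // subn_gt0.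
have FN b : epos N (F b).
  by apply: IHa => //; apply: leq_trans aN; apply: ltnW.
apply: epos_ext (epos_sum (index_enum _) c0 FN) _ => w.
rewrite comp_seriesS mulr_suml; apply: eq_bigr => b _; rewrite /c /F -!mulrA;
  congr (_ * _).
rewrite -natrM mulnb.
suff -> : inj_on b a.+1 w && dist a.+1 N.+1 g w = dist b N.+1 g' w by [].
rewrite inj_onE; symmetry.
have ba := ltn_ord b.
apply/distP/andP => [dw|[/distP dw1 /distP dw2] i j bi bj ij].
  split; apply/distP => i j bi bj ij gij; apply: dw => //; try lia.
    by rewrite /g' !ifT //; lia.
  by rewrite /g' !ifF ?gij //; lia.
rewrite /g'; case: (ltnP i a.+1) => ia; case: (ltnP j a.+1) => ja // gij.
  by apply: dw1 => //; lia.
by apply: dw2 => //; try lia; case: gij.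
Qed.

Lemma epos_triangle N :
  epos N.+1 (fun w => (cycle_col N w && (w N.+1 != w 0) && (w N.+1 != w N))%:R).
Proof.
pose c (a : 'I_N.+1) := cycle_wt (N.+1 - a) - closed_wt (N.+1 - a) *+ 2.
have cl0 (a : 'I_N.+1) : 0 <= closed_wt (N.+1 - a).
  by rewrite closed_wt_ge0 // subn_gt0.
have c0 a : 0 <= c a.
  rewrite /c; set k := (N.+1 - a)%N.
  have -> : cycle_wt k - closed_wt k *+ 2 = closed_wt k * (k%:R - 2).
    by rewrite /cycle_wt /closed_wt; ring.
  have := cl0 a; rewrite -/k; have : (0 < k)%N by rewrite subn_gt0.
  (* For [k = 1] the factor [k - 2] is negative, but [closed_wt 1 = 0]. *)
  case: (k) => [|[|k']] // _ cl.
  by rewrite mulr_ge0 // subr_ge0 ler_nat.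
pose F1 (a : 'I_N.+1) w := run a N.+1 w.
pose F2 (a : 'I_N.+1) w := run a N.+2 w.
have F1N a : epos N.+1 (F1 a).
  (* The label 1 isolates position [N.+1], on which [run a N.+1] puts no condition. *)
  pose g i := nat_of_bool (i == N.+1).
  have aN : (a <= N.+2)%N by have := ltn_ord a; lia.
  apply: epos_ext (epos_comp_dist g aN) _ => w; rewrite /F1 /run inj_onE.
  congr (_ * _%:R); congr nat_of_bool.
  apply/distP/distP => dw i j ai aj ij gij; apply: dw => //.
  - by have := ltn_ord a; lia.
  - by have := ltn_ord a; lia.
  - by rewrite /g; do 2?case: eqP => ?; lia.
  - by move: gij; rewrite /g; do 2?case: eqP => ?; lia.
  - by move: gij; rewrite /g; do 2?case: eqP => ?; lia.
have F2N a : epos N.+1 (F2 a).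
  have aN : (a <= N.+2)%N by have := ltn_ord a; lia.
  apply: epos_ext (epos_comp_dist (fun=> 0%N) aN) _ => w.
  by rewrite /F2 /run inj_onE.
have E1 := epos_sum (index_enum _) c0 F1N.
have E2 := epos_sum (index_enum _) cl0 F2N.
apply: epos_ext (epos_comb ler01 E1 (epos_comb (ler0n _ 2) E2
  (epos_null (null_triangle N)))) _ => w.
by rewrite -/(closed_sum N w) /F1 /F2 /c /closed_sum; ring.
Qed.

(** The cycle is 0, ..., [N], the apex of the triangle [N.+1], followed by [k] more path vertices:
    [m = N.+1] and [l = k.+1]. *)
Definition triangle_path_col (N k : nat) (w : nat -> nat) : bool :=
  [&& cycle_col N w, w N.+1 != w 0, w N.+1 != w N
    & all (fun i => w i.+1 != w i) (iota N.+1 k)].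

Lemma epos_triangle_path N k :
  epos (N.+1 + k) (fun w => (triangle_path_col N k w)%:R).
Proof.
elim: k => [|k IHk].
  rewrite addn0; apply: epos_ext (epos_triangle N) _ => w.
  by rewrite /triangle_path_col /= andbT andbA.
rewrite addnS; apply: epos_ext (epos_path IHk) _ => w.
rewrite /triangle_path_col -[k.+1]addn1 iotaD all_cat /= andbT.
by rewrite -natrM mulnb !andbA.
Qed.

(** * Transfer to set partitions and class coefficients *)

(** Indices above [N] read a default letter; the series in [null N] and [epos N] do not see them. *)
Definition letters N (w : word N.+1) (i : nat) : nat := w (inord i).

Definition ker_partition N (g : nat -> nat) : {set {set 'I_N.+1}} :=
  preim_partition (fun i : 'I_N.+1 => g i) setT.

Lemma ker_partitionP N g : set_partition (ker_partition N g).
Proof. exact: preim_partitionP. Qed.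

Definition ker_block N (g : nat -> nat) (i : 'I_N.+1) : {set 'I_N.+1} :=
  [set j : 'I_N.+1 | g i == g j].

Lemma ker_partitionE N g : ker_partition N g = [set ker_block g i | i :
  'I_N.+1].
Proof.
apply/setP => B; apply/imsetP/imsetP => -[i _ ->]; exists i => //;
  by apply/setP => j; rewrite !inE.
Qed.

Lemma pblock_ker_partition N g (i : 'I_N.+1) :
  pblock (ker_partition N g) i = ker_block g i.
Proof.
have /and3P[_ triv _] := ker_partitionP N g.
apply: def_pblock => //; last by rewrite inE.
by rewrite ker_partitionE imset_f.
Qed.

Lemma e_ker_partition N g (w : word N.+1) :
  e_ (ker_partition N g) w = (dist 0 N.+1 g (letters w))%:R.
Proof.
rewrite /e_ /sum_words; congr (_%:R); congr nat_of_bool.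
apply/idP/distP => [/forall_inP dw i j iN jN ij gij|dw].
  have /dw/forall_inP/(_ (inord i)) : ker_block g (inord i : 'I_N.+1) \in
    ker_partition N g.
    by rewrite ker_partitionE imset_f.
  rewrite inE eqxx => /(_ isT)/forall_inP/(_ (inord j)).
  rewrite inE !inordK // gij eqxx => /(_ isT)/implyP; apply.
  by rewrite -val_eqE /= !inordK.
apply/forall_inP => B; rewrite ker_partitionE => /imsetP[i _ ->].
apply/forall_inP => j; rewrite inE => /eqP gj.
apply/forall_inP => k; rewrite inE => /eqP gk; apply/implyP => jk.
have := dw j k; rewrite /letters !inord_val; apply=> //; first exact: ltn_ord.
  exact: ltn_ord.
by rewrite -gj.
Qed.

Lemma swap_lt N s i : (forall i, (i < N)%N -> (s i < N)%N) ->
  (forall i, (N <= i)%N -> s i = i) -> (i < N.+1)%N -> (s i < N.+1)%N.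
Proof.
by move=> sN Ns; have [/sN iN _|Ni] := ltnP i N; [apply: leqW|rewrite Ns].
Qed.

Lemma dist_involution n s g w :
  involutive s -> (forall i, (i < n)%N -> (s i < n)%N) ->
  dist 0 n g (w \o s) = dist 0 n (g \o s) w.
Proof.
move=> sK sn; apply/distP/distP => dw i j iN jN ij gij.
  have := dw (s i) (s j); rewrite /= !sK; apply; rewrite ?(can_eq sK) //.
    exact: sn.
  exact: sn.
apply: dw; rewrite /= ?sK ?(can_eq sK) //; exact: sn.
Qed.

(** The blocks of [g \o s] are the images under [s] of those of [g], so the sizes agree; as [s]
    fixes [N], the block of [N] goes to the block of [N]. *)
Lemma pequiv_involution N s g pi :
  involutive s -> (forall i, (i < N.+1)%N -> (s i < N.+1)%N) -> s N = N ->
  pequiv pi (ker_partition N (g \o s)) = pequiv pi (ker_partition N g).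
Proof.
move=> sK sN Ns; pose S (i : 'I_N.+1) : 'I_N.+1 := Ordinal (sN i (ltn_ord i)).
have SK : involutive S by move=> i; apply: val_inj; rewrite /= sK.
have injS := inv_inj SK.
have blockE i : ker_block (g \o s) i = S @: ker_block g (S i).
  by apply/setP => j; rewrite -[j in RHS]SK (mem_imset _ _ injS) !inE.
pose T (B : {set 'I_N.+1}) : {set 'I_N.+1} := S @: B.
rewrite /pequiv; congr (_ && _); congr (_ == _).
  rewrite /ptype; apply/perm_sortP; [by move=> a b; rewrite /geq; lia
    |by move=> a b c; rewrite /geq; lia|by move=> a b; rewrite /geq; lia|].
  have partE : ker_partition N (g \o s) = T @: ker_partition N g.
    rewrite !ker_partitionE; apply/setP => B; apply/imsetP/imsetP.
      by move=> [i _ ->]; exists (ker_block g (S i));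
        [apply: imset_f|apply: blockE].
    by move=> [_ /imsetP[i _ ->] ->]; exists (S i); rewrite // blockE SK.
  set P := ker_partition N g in partE *.
  have -> : [seq #|B| | B : {set 'I_N.+1} in P] =
      map (fun B : {set 'I_N.+1} => #|B|) (map T (enum P)).
    by rewrite -map_comp; apply: eq_map => B /=; rewrite card_imset.
  have injT : injective T := imset_inj injS.
  rewrite partE; apply: perm_map; apply: uniq_perm => [||B].
  - exact: enum_uniq.
  - by rewrite map_inj_uniq ?enum_uniq.
  rewrite mem_enum; apply/imsetP/mapP => -[C CN ->]; exists C => //;
    by move: CN; rewrite mem_enum.
apply: eq_bigr => i /eqP[iN]; rewrite !pblock_ker_partition blockE card_imset
  //.
by rewrite (_ : S i = i) //; apply: val_inj; rewrite /= iN.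
Qed.

Lemma e_expansion_comb d a (f g : nc_series d) b c :
  e_expansion f b -> e_expansion g c ->
  e_expansion (fun w => a * f w + g w) (fun pi => a * b pi + c pi).
Proof.
move=> fb gc w; rewrite fb gc mulr_sumr -big_split; apply: eq_bigr => pi _ /=.
by rewrite mulrDl mulrA.
Qed.

Lemma class_coef_comb d a b c (pi : {set {set 'I_d}}) :
  class_coef (fun pi => a * b pi + c pi) pi = a * class_coef b pi + class_coef
    c pi.
Proof. by rewrite /class_coef mulr_sumr -big_split. Qed.

Lemma e_expansion_e d (tau : {set {set 'I_d}}) :
  set_partition tau -> e_expansion (e_ tau) (fun pi => (pi == tau)%:R).
Proof.
move=> tauP w; rewrite (bigD1 tau) //= eqxx mul1r big1 ?addr0 // => pi.
by case/andP=> _ /negPf ->; rewrite mul0r.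
Qed.

Lemma class_coef_e d (tau pi : {set {set 'I_d}}) : set_partition tau ->
  class_coef (fun sigma => (sigma == tau)%:R) pi = (pequiv pi tau)%:R.
Proof.
move=> tauP; rewrite /class_coef; have [eqv|neqv] := boolP (pequiv pi tau).
  rewrite (bigD1 tau) /= ?tauP ?eqv // eqxx big1 ?addr0 // => sigma.
  by case/andP=> _ /negPf ->.
rewrite big1 // => sigma /andP[_ eqv]; case: eqP => // st.
by rewrite -st eqv in neqv.
Qed.

(** By [lin_kernel_inv] the invariant series may be taken to be the e-series of one [g]; the
    difference then involves only the kernels of [g] and [g \o s], which lie in the same class. *)
Lemma null_expansion N f : null N f ->
  exists c, e_expansion (fun w : word N.+1 => f (letters w)) c /\
    forall pi, class_coef c pi = 0.
Proof.
have zero_exp : exists c,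
    e_expansion (fun _ : word N.+1 => 0) c /\ forall pi, class_coef c pi = 0.
  exists (fun=> 0); split=> [w|pi]; last by rewrite /class_coef big1.
  by rewrite big1 // => pi _; rewrite mul0r.
have comb_exp a (f1 f2 : nc_series N.+1) :
    (exists c, e_expansion f1 c /\ forall pi, class_coef c pi = 0) ->
    (exists c, e_expansion f2 c /\ forall pi, class_coef c pi = 0) ->
    exists c, e_expansion (fun w => a * f1 w + f2 w) c /\
      forall pi, class_coef c pi = 0.
  move=> [b [fb b0]] [c [gc c0]]; exists (fun pi => a * b pi + c pi).
  split=> [|pi]; first exact: e_expansion_comb.
  by rewrite class_coef_comb b0 c0 mulr0 addr0.
have ext_exp (f1 f2 : nc_series N.+1) : f1 =1 f2 ->
    (exists c, e_expansion f1 c /\ forall pi, class_coef c pi = 0) ->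
    exists c, e_expansion f2 c /\ forall pi, class_coef c pi = 0.
  by move=> f12 [c [fc c0]]; exists c; split=> // w; rewrite -f12.
elim=> {f} [_ [f [s [fi ss sN Ns ->]]]||a f g _ IHf _ IHg|f g _ IHf fg].
- elim: (lin_kernel_inv fi) => {f fi} [_ [g ->]||a f g _ IHf _ IHg|f g _ IHf
    fg].
  + have gP := ker_partitionP N g; have gsP := ker_partitionP N (g \o s).
    exists (fun pi => -1 * (pi == ker_partition N (g \o s))%:R
                      + (pi == ker_partition N g)%:R).
    have sN1 i := swap_lt (i := i) sN Ns.
    split=> [w|pi]; last first.
      by rewrite class_coef_comb !class_coef_e // pequiv_involution ?Ns //
        mulN1r addNr.
    rewrite -(e_expansion_comb (-1) (e_expansion_e gsP) (e_expansion_e gP)).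
    by rewrite !e_ker_partition dist_involution // mulN1r addrC.
  + by apply: ext_exp zero_exp => w; rewrite subrr.
  + by apply: ext_exp (comb_exp a _ _ IHf IHg) => w /=; ring.
  + by apply: ext_exp IHf => w; rewrite !fg.
- exact: zero_exp.
- by apply: ext_exp (comb_exp a _ _ IHf IHg) => w.
- by apply: ext_exp IHf => w; rewrite fg.
Qed.

Lemma epos_expansion N f : epos N f ->
  exists c, e_expansion (fun w : word N.+1 => f (letters w)) c /\
    forall pi, 0 <= class_coef c pi.
Proof.
elim=> {f} [f fN|g|a f g a0 _ [b [fb b0]] _ [c [gc c0]]|f g _ [c [fc c0]] fg].
- by have [c [fc c0]] := null_expansion fN; exists c; split=> // pi; rewrite c0.
- exists (fun pi => (pi == ker_partition N g)%:R).
  split=> [w|pi]; last by rewrite class_coef_e ?ler0n ?ker_partitionP.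
  by rewrite -e_ker_partition (e_expansion_e (ker_partitionP N g)).
- exists (fun pi => a * b pi + c pi); split=> [|pi];
    first exact: e_expansion_comb.
  by rewrite class_coef_comb addr_ge0 // mulr_ge0.
- by exists c; split=> // w; rewrite -fg.
Qed.

(** The degree is tied to [N.+1] by an equation because [N.+1 + k.+1] and [(N.+1 + k).+1] are equal
    only propositionally. *)
Lemma epos_e_positive d N (G : labeled_graph d) f :
  d = N.+1 -> epos N f ->
  (forall w : nat -> nat, Y G [ffun i : 'I_d => w i] = f w) -> e_positive G.
Proof.
move=> dN; subst d => fN Gf; have [c [fc c0]] := epos_expansion fN.
exists c; split=> // w; rewrite -fc -Gf; congr (Y G _).
by apply/ffunP => i; rewrite ffunE /letters inord_val.
Qed.

(** * The line graph of the tadpole *)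

(** For [N = 0] the closing edge would be a loop, which [line_tadpole] drops but [cycle_col] keeps;
    hence the bound on [N]. *)
Lemma Y_line_tadpole N k (w : nat -> nat) : (0 < N)%N ->
  Y (line_tadpole N.+1 k.+1) [ffun i : 'I_(N.+1 + k.+1) => w i] =
  (triangle_path_col N k w)%:R.
Proof.
move=> N0; rewrite /Y /sum_words; congr (_%:R); congr nat_of_bool.
apply/forallP/and4P => [col|[/andP[/allP colP wN0] w0 wN /allP colL] i].
  have edge i j : (i < N.+1 + k.+1)%N -> (j < N.+1 + k.+1)%N -> i != j ->
      ltp_edge N.+1 i.+1 j.+1 -> w i != w j.
    move=> iN jN ij eij; have /forallP/(_ (Ordinal jN)) := col (Ordinal iN).
    by rewrite !ffunE /= /ltp_adj -val_eqE /= ij eij.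
  split; first apply/andP; first split.
  - by apply/allP => i; rewrite mem_iota /ltp_edge => iN; apply: edge;
      rewrite /ltp_edge; lia.
  - by apply: edge; rewrite /ltp_edge; lia.
  - by rewrite eq_sym; apply: edge; rewrite /ltp_edge; lia.
  - by rewrite eq_sym; apply: edge; rewrite /ltp_edge; lia.
  - apply/allP => i; rewrite mem_iota eq_sym => iN.
    by apply: edge; rewrite /ltp_edge; lia.
have edge a b : (b < N.+1 + k.+1)%N -> ltp_edge N.+1 a.+1 b.+1 -> w a != w b.
  move=> bN; rewrite /ltp_edge => /or4P[|||/orP[]].
  - move=> /andP[/eqP[->] aN]; apply: colP; rewrite mem_iota; lia.
  - by move=> /andP[/eqP[->] /eqP[->]].
  - move=> /andP[/eqP[ba] aN]; rewrite ba in bN *; rewrite eq_sym;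
      apply: colL; rewrite mem_iota; lia.
  - by move=> /andP[/eqP[->] /eqP[->]]; rewrite eq_sym.
  - by move=> /andP[/eqP[->] /eqP[->]]; rewrite eq_sym.
apply/forallP => j; rewrite !ffunE; apply/implyP => /andP[_ /orP[]];
  first exact: edge.
by rewrite eq_sym; apply: edge.
Qed.

Theorem theorem3p3 (m l : nat) (hm : (3 <= m)%N) (hl : (1 <= l)%N) :
  e_positive (line_tadpole m l).
Proof.
case: m l hm hl => [|N] // [|k] // hm _.
have N0 : (0 < N)%N by lia.
exact: epos_e_positive (addnS _ _) (epos_triangle_path N k)
  (fun w => Y_line_tadpole k w N0).
Qed.
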